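(* Let $\theta>0$ and let $X_1,X_2,\dots$ be an exchangeable sequence of positive-integer-valued random variables obtained by independent random sampling from a $\mathsf{GEM}(\theta)$ distribution. For each $n\in\mathbb{N}$, let $M_n=\max\{X_1,\dots,X_n\}$. Then $$M_n-1\overset{d}{=}G_1+\dots+G_n,$$ where $G_1,\dots,G_n$ are independent geometric random variables with distributions $$\mathbb{P}[G_i=k]=\tau_i(1-\tau_i)^k,\qquad k=0,1,2,\dots,\qquad \tau_i=\frac{i}{\theta+i}.$$
   Context: $\mathbb{N}=\{1,2,\dots\}$, and $\overset{d}{=}$ denotes equality in distribution. The $\mathsf{GEM}(\theta)$ distribution ($\theta>0$): let $H_1,H_2,\dots$ be i.i.d. random variables with the beta$(1,\theta)$ distribution, i.e. with density $\theta(1-x)^{\theta-1}$ on $[0,1]$, and put $Y_0=0$, $Y_k=1-\prod_{i=1}^k(1-H_i)$ for $k\in\mathbb{N}$. Then $Y_k\uparrow 1$ a.s., and $(p_i)_{i\ge1}$ with $p_i=Y_i-Y_{i-1}$ is a random probability distribution on $\mathbb{N}$, called the $\mathsf{GEM}(\theta)$ distribution. Independent sampling from it means: given $\mathbf{Y}=(Y_k)_{k\ge1}$, the variables $X_1,X_2,\dots$ are i.i.d. with values in $\mathbb{N}$ and $\mathbb{P}[X_1\le k\mid\mathbf{Y}]=Y_k$ for all $k\in\mathbb{N}$. Probabilities in the claim are unconditional. *)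

(* Defs.v *)
From HB Require Import structures.
From mathcomp Require Import all_boot all_order all_algebra finmap.
From mathcomp Require Import all_classical all_reals all_analysis.

Set Implicit Arguments.
Unset Strict Implicit.
Unset Printing Implicit Defensive.

Import Order.TTheory GRing.Theory Num.Theory.
Import numFieldNormedType.Exports.

Local Open Scope classical_set_scope.
Local Open Scope ring_scope.

Definition eq_in_distribution (R : realType) (d1 d2 d : measure_display)
    (T1 : measurableType d1) (T2 : measurableType d2) (U : measurableType d)
    (P1 : probability T1 R) (P2 : probability T2 R)
    (X1 : T1 -> U) (X2 : T2 -> U) : Prop :=
  forall A : set U, measurable A -> pushforward P1 X1 A = pushforward P2 X2 A.

Definition mutually_independent (R : realType) (d d' : measure_display)
    (T : measurableType d) (U : measurableType d') (P : probability T R)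
    (I : choiceType) (X : I -> T -> U) : Prop :=
  forall (J : {fset I}) (A : I -> set U), (forall i, measurable (A i)) ->
    P (\bigcap_(i in [set` J]) X i @^-1` A i) =
    (\prod_(i <- J) P (X i @^-1` A i))%E.

Definition generated_by (R : realType) (T I : Type) (Y : I -> T -> R) :
    set_system T :=
  <<s \bigcup_i preimage_set_system setT (Y i) measurable >>.

(* [Z] is a version of the conditional probability P[A | G], where [G] is a
   sub-sigma-algebra. *)
Definition is_cond_prob (R : realType) (d : measure_display)
    (T : measurableType d) (P : probability T R) (G : set_system T)
    (A : set T) (Z : T -> R) : Prop :=
  [/\ forall B : set R, measurable B -> G (Z @^-1` B),
      P.-integrable setT (EFin \o Z)
    & forall B, G B -> (\int[P]_(w in B) (Z w)%:E = P (A `&` B))%E].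

Definition cond_independent (R : realType) (d d' : measure_display)
    (T : measurableType d) (U : measurableType d') (P : probability T R)
    (G : set_system T) (I : choiceType) (X : I -> T -> U) : Prop :=
  forall (J : {fset I}) (A : I -> set U) (Z : I -> T -> R),
    (forall i, measurable (A i)) ->
    (forall i, is_cond_prob P G (X i @^-1` A i) (Z i)) ->
    is_cond_prob P G (\bigcap_(i in [set` J]) X i @^-1` A i)
      (fun w => \prod_(i <- J) Z i w).

(* Given the random distribution function [Y] on {1, 2, ...}, the [X i] are
   i.i.d. with P[X i <= k | Y] = Y k. *)
Definition cond_iid_sample (R : realType) (d : measure_display)
    (T : measurableType d) (P : probability T R)
    (Y : nat -> T -> R) (X : nat -> T -> nat) : Prop :=
  cond_independent P (generated_by Y) X /\
  forall i k : nat, (0 < k)%N ->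
    is_cond_prob P (generated_by Y) [set w | (X i w <= k)%N] (Y k).

Definition has_beta1_distribution (R : realType) (d : measure_display)
    (T : measurableType d) (P : probability T R) (theta : R)
    (H : {RV P >-> R}) : Prop :=
  forall A : set R, measurable A ->
    distribution P H A =
    (\int[lebesgue_measure]_(x in A `&` `[0%R, 1%R])
       (theta * (1 - x) `^ (theta - 1))%:E)%E.

(* The sequence H_1, H_2, ... is indexed from 0: [H i] is H_(i+1). *)
Definition stick_breaking (R : realType) (T : Type) (H : nat -> T -> R)
    (k : nat) (w : T) : R :=
  1 - \prod_(i < k) (1 - H i w).

(* [X] is an independent sample from a GEM(theta) random distribution, the
   sequence X_1, X_2, ... being indexed from 0. *)
Definition GEM_sample (R : realType) (d : measure_display)
    (T : measurableType d) (P : probability T R) (theta : R)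
    (X : nat -> T -> nat) : Prop :=
  exists H : nat -> {RV P >-> R},
    [/\ mutually_independent P H,
        forall i, has_beta1_distribution theta (H i)
      & cond_iid_sample P (stick_breaking H) X].

Definition has_geometric_distribution (R : realType) (d : measure_display)
    (T : measurableType d) (P : probability T R) (p : R)
    (N : {RV P >-> nat}) : Prop :=
  forall k : nat, distribution P N [set k] = (p * (1 - p) ^+ k)%:E.

(* Main.v *)
Require Import Defs.
From HB Require Import structures.
From mathcomp Require Import all_boot all_order all_algebra finmap.
From mathcomp Require Import all_classical all_reals all_analysis.
From mathcomp Require Import measurable_realfun ring lra.

Set Implicit Arguments.
Unset Strict Implicit.
Unset Printing Implicit Defensive.

Import Order.TTheory GRing.Theory Num.Theory.
Import numFieldNormedType.Exports.

Local Open Scope classical_set_scope.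
Local Open Scope ring_scope.

(** Both sides turn out to have the same probability mass function, because
    the two distribution functions obey the same recurrence.

    Given the stick-breaking sequence [Y], the event [M_n <= k] has probability
    [Y_k ^ n], so unconditionally it has probability [E (Y_k ^ n)]
    ([GEM_max_cdf]). Now [1 - Y_k] is a product of [k] independent variables
    [1 - H_i], each with [m]-th moment [theta / (theta + m)] ([beta1_moment]);
    moments of the product multiply ([integral_prod_independent]), and the
    binomial expansion of [(1 - (1 - Y_k)) ^ n] gives the closed form
    [a n k = \sum_m (-1) ^ m 'C(n, m) (theta / (theta + m)) ^ k]
    ([stick_breaking_moment]).

    With [tau = (n + 1) / (theta + n + 1)], comparing coefficients yields
    [a (n + 1) (k + 1) = tau * a n (k + 1) + (1 - tau) * a (n + 1) k]
    ([stick_moment_rec]). This is precisely how a distribution function changes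
    when an independent geometric variable of parameter [tau] is added: either
    that variable is zero, or it is one plus a fresh copy of itself. Hence the
    mass function of [M_(n+1) - 1] is the convolution of that of [M_n - 1] with
    a geometric law ([GEM_max_pmf_convolution]), the unit mass at 0 playing the
    part of the law for [n = 0], and the partial sums of the [G_i] have the
    same mass functions ([geometric_sum_law]). *)

(** * Change of variables along a density *)

Section density.
Context d1 d2 (T : measurableType d1) (U : measurableType d2) (R : realType).
Import HBNNSimple.
Local Open Scope ereal_scope.

(** Change of variables when [nu] is the image under [phi] of the measure with
    density [g] with respect to [mu]. Only the values of [nu] on sets are
    assumed, so the integrals are compared through simple functions and
    monotone convergence. *)
Lemma ge0_integral_density (mu : {measure set T -> \bar R})
    (nu : {measure set U -> \bar R}) (phi : T -> U) (g : T -> R) :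
  measurable_fun setT phi -> measurable_fun setT g ->
  (forall x, (0 <= g x)%R) ->
  (forall A, measurable A -> nu A = \int[mu]_(x in phi @^-1` A) (g x)%:E) ->
  forall f : U -> \bar R, measurable_fun setT f -> (forall y, 0 <= f y) ->
  \int[nu]_y f y = \int[mu]_x (f (phi x) * (g x)%:E).
Proof.
move=> mphi mg g0 nuE f mf f0.
pose f_ := nnsfun_approx measurableT mf.
have mf_ n : measurable_fun setT (fun x => (f_ n (phi x))%:E).
  by apply/measurable_EFinP; apply: measurableT_comp.
have mgE : measurable_fun setT (EFin \o g) by exact/measurable_EFinP.
transitivity (limn (fun n => \int[nu]_x (f_ n x)%:E)).
  rewrite -monotone_convergence//=.
  - apply: eq_integral => x _; apply/esym/cvg_lim => //=.
    by apply: cvg_nnsfun_approx => // y _; exact: f0.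
  - by move=> n; exact/measurable_EFinP.
  - by move=> n x _; rewrite lee_fin.
  - move=> x _ a b /(nd_nnsfun_approx measurableT mf).
    by rewrite lee_fin => /lefP; apply.
transitivity (limn (fun n =>
    \int[mu]_x ((f_ n (phi x))%:E * (g x)%:E))); last first.
  rewrite -monotone_convergence//=.
  - apply: eq_integral => x _; apply/cvg_lim => //=.
    apply: cvgeZr => //.
    by apply: cvg_nnsfun_approx => // y _; exact: f0.
  - by move=> n; apply: emeasurable_funM.
  - by move=> n x _; rewrite mule_ge0// lee_fin.
  - move=> x _ a b /(nd_nnsfun_approx measurableT mf) ab.
    by rewrite lee_wpmul2r ?lee_fin//; move/lefP: ab; apply.
congr (limn _); apply/funext => n.
have mind r : measurable_fun setT
    (fun x : T => (\1_(f_ n @^-1` [set r]) (phi x) : R)).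
  by apply: measurableT_comp => //; exact: measurable_indic.
have fimE y : (f_ n y)%:E =
    \sum_(r \in range (f_ n)) (r * \1_(f_ n @^-1` [set r]) y)%:E.
  by rewrite {1}fimfunE -fsumEFin.
under eq_integral do rewrite fimE.
under [RHS]eq_integral.
  move=> x _; rewrite fimE ge0_mule_fsuml; last first.
    by move=> r; rewrite EFinM nnfun_muleindic_ge0.
  over.
have ind0 r y : 0 <= (r * \1_(f_ n @^-1` [set r]) y)%:E.
  by rewrite EFinM nnfun_muleindic_ge0.
have mI r : measurable_fun [set: U] (fun y => (r * \1_(f_ n @^-1` [set r]) y)%:E).
  exact/measurable_EFinP/measurable_funM.
rewrite ge0_integral_fsum//.
rewrite ge0_integral_fsum//; last 2 first.
- move=> r; apply: emeasurable_funM => //.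
  by apply: measurableT_comp (mI r) _.
- by move=> r x _; rewrite mule_ge0// lee_fin.
apply: eq_fsbigr => r /set_mem [y _ <-].
have r0 : (0 <= f_ n y)%R by [].
move: (f_ n y) r0 => {y} r r0.
under eq_integral do rewrite EFinM.
rewrite ge0_integralZl//; last exact/measurable_EFinP/measurable_indic.
rewrite integral_indic// setIT nuE//.
under [RHS]eq_integral do rewrite EFinM -muleA.
rewrite ge0_integralZl//; last 2 first.
- by apply: emeasurable_funM => //; exact/measurable_EFinP.
- by move=> x _; rewrite mule_ge0// lee_fin.
congr (_ * _).
rewrite integral_mkcond; apply: eq_integral => x _.
rewrite patchE indicE; case: ifPn => [/set_mem|/negP] h.
  by rewrite mem_set// mul1e.
by rewrite memNset ?mul0e// => /mem_set; exact: h.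
Qed.

End density.

(** * Expectation of a product of functions of independent variables *)

Section expectation_product.
Context (R : realType) (d d' : measure_display).
Context (T : measurableType d) (U : measurableType d').
Context (P : probability T R) (I : choiceType) (X : I -> {RV P >-> U}).
Hypothesis indepX : mutually_independent P X.
Local Open Scope ereal_scope.

Let integral_prod_indic (s : seq I) (A : I -> set U) :
  uniq s -> (forall i, measurable (A i)) ->
  \int[P]_w (\prod_(i <- s) \1_(A i) (X i w))%:E =
  \prod_(i <- s) P (X i @^-1` A i).
Proof.
move=> us mA; have sE : perm_eq s [fset i in s]%fset.
  by apply: uniq_perm => // i; rewrite !inE.
rewrite [RHS](perm_big _ sE) -(indepX _ mA).
set B := \bigcap_(i in _) _.
have mB : measurable B.
  apply: fin_bigcap_measurable; first exact: finite_fset.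
  by move=> i _; exact: measurable_funPTI.
rewrite -[in RHS](setIT B) -integral_indic//.
apply: eq_integral => w _; congr (_%:E).
rewrite [in RHS]indicE; have [/set_mem Bw|/negP Bw] := boolP (w \in B).
  rewrite big_seq big1// => i si; rewrite indicE mem_set//.
  by apply: Bw => /=; rewrite inE.
apply/eqP; rewrite prodf_seq_eq0; apply/hasP.
apply: contra_notP Bw => nB; apply/mem_set => i /=; rewrite inE => si.
apply: contrapT => nA; apply: nB; exists i => //=.
by rewrite indicE memNset.
Qed.

(** Interpolates between the definition of independence, where all factors are
    indicators, and the general product rule: induction on [r] turns one
    indicator after the other into a function. If [V] is the product of the
    other factors, the rule for all indicators of [X i] says that the law of
    [X i], scaled by the mean of [V], is the image under [X i] of the measure
    with density [V]; a change of variables then gives it for functions of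
    [X i]. *)
Let integral_prod_mixed (r s : seq I) (f : I -> U -> R) (A : I -> set U) :
  uniq (r ++ s) ->
  (forall i, measurable_fun setT (f i)) -> (forall i y, (0 <= f i y)%R) ->
  (forall i, \int[P]_w (f i (X i w))%:E < +oo) ->
  (forall i, measurable (A i)) ->
  \int[P]_w (\prod_(i <- r) f i (X i w) * \prod_(i <- s) \1_(A i) (X i w))%:E =
  \prod_(i <- r) \int[P]_w (f i (X i w))%:E * \prod_(i <- s) P (X i @^-1` A i).
Proof.
move=> + mf f0 foo; elim: r s A => [|i r IH] s A urs mA.
  rewrite big_nil mul1e -integral_prod_indic//.
  by apply: eq_integral => w _; rewrite big_nil mul1r.
pose V w := (\prod_(i <- r) f i (X i w) * \prod_(i <- s) \1_(A i) (X i w))%R.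
have V0 w : (0 <= V w)%R.
  by rewrite mulr_ge0// prodr_ge0// => j _; rewrite indicE.
have mV : measurable_fun setT V.
  apply: measurable_funM; apply: measurable_prod => j _.
    exact: measurableT_comp.
  by apply: (measurableT_comp (measurable_indic (mA j))).
set c := \prod_(j <- r) \int[P]_w (f j (X j w))%:E *
         \prod_(j <- s) P (X j @^-1` A j).
have c0 : 0 <= c.
  apply: mule_ge0; first apply: prode_ge0 => j _; last exact: prode_ge0.
  by apply: integral_ge0 => w _; rewrite lee_fin.
have cfin : c \is a fin_num.
  apply: fin_numM; apply: prode_fin_num => j _; last first.
    by rewrite fin_num_measure//; exact: measurable_funPTI.
  by rewrite ge0_fin_numE// integral_ge0// => w _; rewrite lee_fin.
have ci : (0 <= fine c)%R by exact: fine_ge0.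
have iNrs : i \notin r ++ s by case/andP: urs.
have key B : measurable B -> mscale (NngNum ci) (distribution P (X i)) B =
    \int[P]_(w in X i @^-1` B) (V w)%:E.
  move=> mB; pose A' j := if j == i then B else A j.
  have A'E j : j \in s -> A' j = A j.
    rewrite /A'; case: eqP => // -> si.
    by move: iNrs; rewrite mem_cat si orbT.
  have mA' j : measurable (A' j) by rewrite /A'; case: ifP.
  have A'i : A' i = B by rewrite /A' eqxx.
  have A'P : \prod_(j <- s) P (X j @^-1` A' j) =
      \prod_(j <- s) P (X j @^-1` A j).
    by apply: eq_big_seq => j /A'E ->.
  have A'1 w : (\prod_(j <- s) \1_(A' j) (X j w) =
      \prod_(j <- s) \1_(A j) (X j w) :> R)%R.
    by apply: eq_big_seq => j /A'E ->.
  have uris : uniq (r ++ i :: s).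
    by rewrite (perm_uniq (permEl (perm_catCA r [:: i] s))).
  have := IH (i :: s) A' uris mA'.
  rewrite big_cons A'i A'P muleCA -/c muleC /mscale/= fineK// => <-.
  rewrite [RHS]integral_mkcond; apply: eq_integral => w _.
  rewrite patchE big_cons A'i A'1 mulrCA -/(V w) indicE.
  case: ifPn => [/set_mem|/negP] h; first by rewrite mem_set// mul1r.
  by rewrite memNset ?mul0r// => h'; apply: h; exact: mem_set.
have := @ge0_integral_density _ _ _ _ _ P
  (mscale (NngNum ci) (distribution P (X i))) (X i) V _ mV V0 key (EFin \o f i).
rewrite ge0_integral_mscale//=; last 2 first.
- exact/measurable_EFinP.
- by move=> y _; rewrite lee_fin.
rewrite ge0_integral_distribution//=; last 2 first.
- exact/measurable_EFinP.
- by move=> y; rewrite lee_fin.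
rewrite fineK// => densityE.
rewrite [X in _ = X * _]big_cons -muleA -/c muleC densityE//; last 2 first.
- exact/measurable_EFinP.
- by move=> y; rewrite lee_fin.
by apply: eq_integral => w _; rewrite big_cons -mulrA -EFinM.
Qed.

Lemma integral_prod_independent (r : seq I) (f : I -> U -> R) :
  uniq r ->
  (forall i, measurable_fun setT (f i)) -> (forall i y, (0 <= f i y)%R) ->
  (forall i, \int[P]_w (f i (X i w))%:E < +oo) ->
  \int[P]_w (\prod_(i <- r) f i (X i w))%:E =
  \prod_(i <- r) \int[P]_w (f i (X i w))%:E.
Proof.
move=> ur mf f0 foo.
have := @integral_prod_mixed r [::] f (fun=> setT); rewrite cats0 big_nil mule1.
move=> <-//; apply: eq_integral => w _; by rewrite big_nil mulr1.
Qed.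

End expectation_product.

(** * Moments of the beta(1, theta) law *)

Section beta1_moments.
Context (R : realType).
Implicit Types (theta p c x : R).

Let cvg_onem_powR p : 0 < p -> (1 - x) `^ p @[x --> 1^'-] --> 0.
Proof.
move=> p0; apply: (cvg_comp (fun x : R => 1 - x) (fun y => y `^ p)).
  2: exact: powR_cvg0.
move=> A [e /= e0 eA]; exists e => //= x /= xe x1; apply: eA => /=; last lra.
by rewrite sub0r normrN.
Qed.

Let is_derive_onem_powR p x : x < 1 ->
  is_derive x 1 (fun y => (1 - y) `^ p) (- (p * (1 - x) `^ (p - 1))).
Proof.
move=> x1; have x0 : 0 < 1 - x by lra.
have d1 : is_derive x 1 (fun y : R => 1 - y) (-1).
  by apply: is_derive_eq; rewrite add0r mul1r.
have := @is_derive1_comp _ (fun y => y `^ p) (fun y => 1 - y) _ _ _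
  (is_derive1_powR p x0) d1.
by rewrite mulrN1.
Qed.

Let derivable_onem_powR c p : 0 < p ->
  derivable_oo_LRcontinuous (fun x => c * (1 - x) `^ p) 0 1.
Proof.
move=> p0; split.
- move=> x /[!in_itv]/= /andP[_ x1].
  by apply: derivableM => //; have [] := is_derive_onem_powR p x1.
- apply: cvgM; first exact: cvg_cst.
  apply: cvg_at_right_filter.
  have [+ _] := is_derive_onem_powR p (@ltr01 R).
  by move=> /derivable1_diffP/differentiable_continuous.
- rewrite subrr powR0 ?gt_eqF//.
  by apply: cvgM; [exact: cvg_cst|exact: cvg_onem_powR].
Qed.

(** The assumption [1 < p] makes the integrand continuous up to the endpoint 1,
    as the fundamental theorem of calculus requires. *)
Lemma integral_onem_powR theta p : 1 < p ->
  (\int[lebesgue_measure]_(x in `[0%R, 1%R]) (theta * (1 - x) `^ (p - 1))%:E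
   = (theta / p)%:E)%E.
Proof.
move=> p1; have p0 : 0 < p by lra.
rewrite (@continuous_FTC2 _ _ (fun x => - (theta / p) * (1 - x) `^ p))//.
- by rewrite subrr subr0 powR0 ?gt_eqF// powR1 mulr0 sub0e mulr1 -EFinN opprK.
- by apply: derivable_oo_LRcontinuous_within; apply: derivable_onem_powR; lra.
- exact: derivable_onem_powR.
- move=> x /[!in_itv]/= /andP[_ x1].
  have dp := is_derive_onem_powR p x1.
  rewrite derive1E; apply: derive_val; apply: is_derive_eq.
  rewrite /GRing.scale/=; field; lra.
Qed.

Context (d : measure_display) (T : measurableType d) (P : probability T R).
Variables (theta : R) (H : {RV P >-> R}).
Hypotheses (theta_gt0 : 0 < theta) (betaH : has_beta1_distribution theta H).

Lemma beta1_itv01 : {ae P, forall w, 0 <= H w <= 1}.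
Proof.
have H1 : P (H @^-1` `[0%R, 1%R]%classic) = 1%E.
  have -> : P (H @^-1` `[0%R, 1%R]%classic) =
    distribution P H `[0%R, 1%R]%classic by [].
  (* the law of [H] integrates its density over [0, 1] only, so [0, 1] and the
     whole line have the same mass *)
  by rewrite betaH// setIid -(setTI `[0%R, 1%R]%classic) -betaH// probability_setT.
have mH : measurable (H @^-1` `[0%R, 1%R]%classic).
  exact: measurable_funPTI.
have : P.-negligible (~` (H @^-1` `[0%R, 1%R]%classic)).
  apply/negligibleP; first exact: measurableC.
  by apply: etrans (probability_setC P mH) _; rewrite H1 subee.
by apply: negligibleS; apply: subsetC => w /=; rewrite in_itv.
Qed.

(** Absolute values make the variables nonnegative everywhere rather than almost
    surely. The case [m = 0] holds because [P] has mass 1; it is kept apart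
    since the density may be unbounded near 1 when [theta < 1], whereas the
    extra factor [1 - x] of the other cases removes the singularity. *)
Lemma beta1_moment m :
  (\int[P]_w (`|1 - H w| ^+ m)%:E = (theta / (theta + m%:R))%:E)%E.
Proof.
case: m => [|m].
  under eq_integral do rewrite expr0.
  rewrite integral_cst// mul1e addr0 divff ?gt_eqF//.
  exact: probability_setT.
have t0 := theta_gt0.
pose g (x : measurableTypeR R) : R :=
  theta * (1 - x) `^ (theta - 1) * \1_`[0, 1]%classic x.
pose f (x : R) := (`|1 - x| ^+ m.+1)%:E.
have mf : measurable_fun setT f.
  apply/measurable_EFinP/measurable_funX/measurableT_comp => //.
  exact: measurable_funB.
have mg : measurable_fun setT g.
  apply: measurable_funM; last exact: measurable_indic.
  apply: measurable_funM => //.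
  apply: (measurableT_comp (measurable_powR (theta - 1))).
  exact: measurable_funB.
have g0 x : 0 <= g x by rewrite !mulr_ge0// ?indicE// ?powR_ge0// ltW.
have f0 x : (0 <= f x)%E by rewrite lee_fin.
rewrite -(@ge0_integral_distribution _ _ _ _ _ P H f)//.
rewrite (@ge0_integral_density _ _ _ _ _ lebesgue_measure
  (distribution P H) id g)//; last first.
  move=> A mA; apply: etrans (betaH mA) _.
  rewrite integral_mkcondr; apply: eq_integral => x _.
  rewrite /g patchE indicE; case: ifPn => h; last by rewrite mulr0.
  by rewrite mulr1.
have -> : (theta / (theta + m.+1%:R))%:E =
   (\int[lebesgue_measure]_(x in `[0%R, 1%R])
      (theta * (1 - x) `^ (theta + m.+1%:R - 1))%:E)%E.
  rewrite integral_onem_powR// -natr1.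
  by have := ler0n R m; lra.
rewrite [RHS]integral_mkcond; apply: eq_integral => x _.
rewrite /f /g -EFinM patchE indicE mem_setE; case: ifPn => h; last by rewrite !mulr0.
move: h; rewrite in_itv/= => /andP[x0 x1].
rewrite ger0_norm ?subr_ge0// mulr1 mulrCA -powR_mulrn ?subr_ge0// -powRD.
  by congr (theta * _ `^ _)%:E; ring.
apply/implyP => /eqP; rewrite -natr1.
by have := ler0n R m; lra.
Qed.

End beta1_moments.

(** * Moments of the stick-breaking process *)

(** The closed form of the [n]-th moment of [Y_k], which is also the probability
    that the maximum of [n] samples is at most [k]. *)
Definition stick_moment (R : realType) (theta : R) (n k : nat) : R :=
  \sum_(m < n.+1) (-1) ^+ m * 'C(n, m)%:R * (theta / (theta + m%:R)) ^+ k.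

Section stick_breaking_moments.
Context (R : realType) (d : measure_display) (T : measurableType d).
Context (P : probability T R) (theta : R) (H : nat -> {RV P >-> R}).
Hypotheses (theta_gt0 : 0 < theta) (indepH : mutually_independent P H).
Hypothesis betaH : forall i, has_beta1_distribution theta (H i).

Let remainder k w := \prod_(i < k) `|1 - H i w|.

Let measurable_remainder k : measurable_fun setT (remainder k).
Proof.
apply: measurable_prod => i _; apply: measurableT_comp => //.
exact: measurable_funB.
Qed.

Let remainder_moment k m :
  (\int[P]_w (remainder k w ^+ m)%:E = ((theta / (theta + m%:R)) ^+ k)%:E)%E.
Proof.
pose f (i : nat) (y : R) := `|1 - y| ^+ m.
have -> : (\int[P]_w (remainder k w ^+ m)%:E =
    \int[P]_w (\prod_(i <- index_iota 0 k) f i (H i w))%:E)%E.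
  by apply: eq_integral => w _; rewrite big_mkord prodrXl.
rewrite (integral_prod_independent indepH) ?iota_uniq//.
- under eq_bigr do rewrite (beta1_moment theta_gt0)//.
  by rewrite prodEFin prodr_const_nat subn0.
- move=> i; apply: measurable_funX; apply: measurableT_comp => //.
  exact: measurable_funB.
- by move=> i y; rewrite /f exprn_ge0.
- by move=> i; rewrite (beta1_moment theta_gt0)// ltry.
Qed.

Lemma stick_breaking_moment k n :
  (\int[P]_w (stick_breaking H k w ^+ n)%:E = (stick_moment theta n k)%:E)%E.
Proof.
have mR m : measurable_fun setT (fun w => (remainder k w ^+ m)%:E).
  by apply/measurable_EFinP; exact: measurable_funX.
have iR m : P.-integrable setT (fun w => (remainder k w ^+ m)%:E).
  apply/integrableP; split => //.
  under eq_integral do rewrite gee0_abs ?lee_fin ?exprn_ge0 ?prodr_ge0//.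
  by rewrite remainder_moment ltry.
have term m : (\int[P]_w (((-1) ^+ m * 'C(n, m)%:R)%:E * (remainder k w ^+ m)%:E) =
    ((-1) ^+ m * 'C(n, m)%:R * (theta / (theta + m%:R)) ^+ k)%:E)%E.
  by rewrite integralZl// remainder_moment -EFinM.
transitivity (\int[P]_w (\sum_(m < n.+1)
    ((-1) ^+ m * 'C(n, m)%:R)%:E * (remainder k w ^+ m)%:E))%E; last first.
  rewrite integral_sum//; last by move=> m; exact: integrableZl.
  by rewrite /stick_moment -sumEFin; apply: eq_bigr => m _; rewrite term.
apply: ae_eq_integral => //.
- apply/measurable_EFinP/measurable_funX/measurable_funB => //.
  by apply: measurable_prod => i _; exact: measurable_funB.
- apply: emeasurable_sum => m.
  by apply: emeasurable_funM => //; exact: measurable_cst.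
(* almost surely every [H i] is at most 1, which removes the absolute values *)
have := ae_foralln (fun i => beta1_itv01 (betaH i)).
apply: filterS => w H01 _.
have -> : stick_breaking H k w = 1 - remainder k w.
  congr (1 - _); apply: eq_bigr => i _.
  by rewrite ger0_norm// subr_ge0; have /andP[] := H01 i.
rewrite exprBn -sumEFin; apply: eq_bigr => m _.
by rewrite expr1n mulr1 -EFinM -mulr_natr mulrAC.
Qed.

End stick_breaking_moments.

(** * The recurrence satisfied by the moments *)

Section stick_moment_recurrence.
Context (R : realType) (theta : R).
Hypothesis theta_gt0 : 0 < theta.

Lemma stick_moment0 k : stick_moment theta 0 k = 1.
Proof.
rewrite /stick_moment big_ord1 expr0 bin0 addr0 divff ?gt_eqF//.
by rewrite expr1n !mulr1.
Qed.

Lemma stick_momentS0 n : stick_moment theta n.+1 0 = 0.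
Proof.
have := @exprBn R 1 1 n.+1; rewrite subrr expr0n/= => E; rewrite [RHS]E.
by apply: eq_bigr => m _; rewrite !expr1n !mulr1 mulr_natr.
Qed.

(** The coefficients of [(theta / (theta + m)) ^ k] agree on both sides, by
    [(n + 1) 'C(n, m) = (n + 1 - m) 'C(n + 1, m)]. *)
Lemma stick_moment_rec n k :
  let tau := n.+1%:R / (theta + n.+1%:R) in
  stick_moment theta n.+1 k.+1 =
  tau * stick_moment theta n k.+1 + (1 - tau) * stick_moment theta n.+1 k.
Proof.
move=> tau; have n0 : theta + n.+1%:R != 0 by rewrite gt_eqF// addr_gt0.
have -> : stick_moment theta n k.+1 = \sum_(m < n.+2)
    (-1) ^+ m * 'C(n, m)%:R * (theta / (theta + m%:R)) ^+ k.+1.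
  by rewrite big_ord_recr/= bin_small// mulr0 mul0r addr0.
rewrite /stick_moment !mulr_sumr -big_split/=; apply: eq_bigr => m _.
have m0 : theta + m%:R != 0 by rewrite gt_eqF// ltr_wpDr.
have binE : n.+1%:R * 'C(n, m)%:R = (n.+1%:R - m%:R) * 'C(n.+1, m)%:R :> R.
  by rewrite -natrB -1?ltnS// -!natrM mul_bin_down.
set x := theta / (theta + m%:R).
suff E : (theta + n.+1%:R) * 'C(n.+1, m)%:R * x =
    n.+1%:R * 'C(n, m)%:R * x + theta * 'C(n.+1, m)%:R :> R.
  apply: (mulfI n0); rewrite mulrDr exprS.
  transitivity ((-1) ^+ m * x ^+ k * ((theta + n.+1%:R) * 'C(n.+1, m)%:R * x)).
    by ring.
  by rewrite E /tau; field; rewrite nat1r.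
by rewrite binE /x; field.
Qed.

(** The mass at [j] of [M_n - 1], as a difference of values of the distribution
    function of [M_n]. The factor [0 < j] matters only for [n = j = 0], where
    [stick_moment] is 1: it makes the law for [n = 0] the unit mass at 0, the
    law of an empty sum. *)
Definition GEM_max_pmf n j : R :=
  stick_moment theta n j.+1 - (0 < j)%:R * stick_moment theta n j.

Lemma GEM_max_pmf0 j : GEM_max_pmf 0 j = (j == 0)%:R.
Proof.
rewrite /GEM_max_pmf !stick_moment0; case: j => [|j].
  by rewrite mul0r subr0.
by rewrite mul1r subrr.
Qed.

(** The recurrence splits off the value 0 of the geometric variable; unfolding it
    down to 0 produces the convolution. *)
Lemma GEM_max_pmf_convolution n s :
  let tau := n.+1%:R / (theta + n.+1%:R) in
  GEM_max_pmf n.+1 s =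
  \sum_(t < s.+1) tau * (1 - tau) ^+ t * GEM_max_pmf n (s - t).
Proof.
move=> tau; elim: s => [|s IH].
  rewrite big_ord1 /GEM_max_pmf !mul0r !subr0 stick_moment_rec -/tau.
  by rewrite stick_momentS0; ring.
rewrite big_ord_recl/= subn0 expr0 mulr1.
transitivity (tau * GEM_max_pmf n s.+1 + (1 - tau) * GEM_max_pmf n.+1 s).
  rewrite /GEM_max_pmf (stick_moment_rec n s.+1).
  rewrite {2}(stick_moment_rec n s) -/tau.
  by case: s {IH} => [|s]/=; rewrite ?stick_momentS0; ring.
rewrite IH mulr_sumr; congr (_ + _); apply: eq_bigr => t _.
by rewrite subSS exprS; ring.
Qed.

End stick_moment_recurrence.

(** * Sums of independent geometric variables *)

Section geometric_sum.
Context (R : realType) (theta : R) (d : measure_display) (T : measurableType d).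
Context (Q : probability T R) (n : nat) (G : 'I_n -> {RV Q >-> nat}).
Hypotheses (theta_gt0 : 0 < theta) (indepG : mutually_independent Q G).
Hypothesis geomG : forall i : 'I_n,
  has_geometric_distribution (i.+1%:R / (theta + i.+1%:R)) (G i).

Let measurable_G i (A : set nat) : measurable (G i @^-1` A).
Proof. exact: measurable_funPTI. Qed.

Let event m s (A : 'I_n -> set nat) : set T :=
  [set w | (\sum_(i < n | (i < m)%N) G i w)%N = s /\ forall i, A i (G i w)].

Let measurable_partial_sum (r : seq 'I_n) (p : pred 'I_n) :
  measurable_fun setT (fun w => \sum_(i <- r | p i) G i w)%N.
Proof.
elim: r => [|i r IH].
  by under eq_fun do rewrite big_nil; exact: measurable_cst.
under eq_fun do rewrite big_cons.
by case: (p i) => //; apply: measurable_fun_addn.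
Qed.

Let measurable_event m s A : measurable (event m s A).
Proof.
have -> : event m s A = (fun w => \sum_(i < n | (i < m)%N) G i w)%N @^-1` [set s]
    `&` \bigcap_(i in [set: 'I_n]) (G i @^-1` A i).
  by apply/seteqP; split => w [E H]; split => // i; [move=> _|]; exact: H.
apply: measurableI; last exact: fin_bigcap_measurable.
by rewrite -[X in measurable X]setTI; exact: measurable_partial_sum.
Qed.

(** Carrying the events on all the [G i] along replaces a separate proof that the
    partial sums are independent of the later variables: the step from [m] to
    [m + 1] splits according to the value [t] of [G m], and the singleton of
    [t] becomes the [m]-th set of the family. *)
Let joint_law m s (A : 'I_n -> set nat) : (m <= n)%N ->
  (forall i : 'I_n, (i < m)%N -> A i = setT) ->
  Q (event m s A) =
  ((GEM_max_pmf theta m s)%:E * \prod_(i < n) Q (G i @^-1` A i))%E.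
Proof.
elim: m s A => [|m IH] s A mn AT.
  rewrite GEM_max_pmf0//; have [->|s0] := eqVneq s 0%N; last first.
    rewrite mul0e (_ : event _ _ _ = set0) ?measure0//.
    apply/seteqP; split => // w [sE _].
    by rewrite -sE big_pred0 ?eqxx in s0.
  rewrite mul1e; have -> : event 0 0 A =
      \bigcap_(i in [set` [fset i | i : 'I_n]%fset]) G i @^-1` A i.
    apply/seteqP; split => w.
      by move=> [_ H] i _; exact: H.
    move=> H; split; first by rewrite big_pred0.
    by move=> i; apply: H => /=; rewrite !inE.
  rewrite indepG//; apply: perm_big; apply: uniq_perm => //.
    exact: index_enum_uniq.
  by move=> i; rewrite mem_index_enum !inE.
pose im := Ordinal mn.
pose At t i := if i == im then [set t] else A i.
have sumS w : (\sum_(i < n | (i < m.+1)%N) G i w =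
    \sum_(i < n | (i < m)%N) G i w + G im w)%N.
  rewrite (bigD1 im)//= addnC; congr (_ + _)%N; apply: eq_bigl => i.
  by rewrite ltnS -(inj_eq val_inj) andbC ltn_neqAle.
have At_neq t i : i != im -> At t i = A i by rewrite /At => /negbTE ->.
have At_im t : At t im = [set t] by rewrite /At eqxx.
have -> : event m.+1 s A = \big[setU/set0]_(t < s.+1) event m (s - t) (At t).
  rewrite -(bigcup_mkord s.+1 (fun t => event m (s - t) (At t))).
  apply/seteqP; split => w.
    move=> [E H]; exists (G im w); first by rewrite /= ltnS -E sumS leq_addl.
    split; first by rewrite -E sumS addnK.
    move=> i; have [->|iim] := eqVneq i im; first by rewrite At_im.
    by rewrite At_neq//; exact: H.
  move=> [t /= ts [E H]]; have := H im; rewrite At_im /= => Gt; split.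
    by rewrite sumS E Gt subnK.
  move=> i; have [->|iim] := eqVneq i im; first by rewrite AT.
  by rewrite -(At_neq t)//; exact: H.
rewrite (@measure_bigsetU _ _ _ Q (fun t => event m (s - t) (At t)))//; last first.
  apply/trivIsetP => t u _ _ tu; apply/seteqP; split => // w [[_ Ht] [_ Hu]].
  have := Ht im; have := Hu im; rewrite !At_im /= => -> /eqP.
  by rewrite eq_sym (negbTE tu).
set c := (\prod_(i < n | i != im) Q (G i @^-1` A i))%E.
have cfin : c \is a fin_num.
  by apply: prode_fin_num => i _; exact: fin_num_measure.
rewrite (bigD1 im)//= -/c AT// preimage_setT [Q _]probability_setT mul1e.
rewrite -(fineK cfin) GEM_max_pmf_convolution// -EFinM mulr_suml -sumEFin.
apply: eq_bigr => t _; rewrite IH; last 2 first.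
- exact: ltnW.
- move=> i im'; rewrite At_neq ?AT//; first exact: ltnW.
  by rewrite -(inj_eq val_inj)/= ltn_eqF.
rewrite (bigD1 im)//= At_im.
rewrite [X in (_ * (_ * X))%E](_ : _ = c); last first.
  by apply: eq_bigr => i iim; rewrite At_neq.
rewrite [Q _](geomG im t) -(fineK cfin) -!EFinM; congr (_%:E).
by rewrite mulrA; congr (_ * _); rewrite mulrC.
Qed.

Lemma geometric_sum_law s :
  Q [set w | (\sum_(i < n) G i w)%N = s] = (GEM_max_pmf theta n s)%:E.
Proof.
have -> : [set w | (\sum_(i < n) G i w)%N = s] = event n s (fun=> setT).
  apply/seteqP; split => w; rewrite /event/=.
    by move=> <-; split => //; apply: eq_bigl => i; rewrite ltn_ord.
  by move=> [<- _]; apply: eq_bigl => i; rewrite ltn_ord.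
rewrite joint_law// big1 ?mule1// => i _.
by rewrite preimage_setT probability_setT.
Qed.

Lemma measurable_geometric_sum s :
  measurable ((fun w => \sum_(i < n) G i w)%N @^-1` [set s]).
Proof.
by rewrite -[X in measurable X]setTI; exact: measurable_partial_sum.
Qed.

End geometric_sum.

(** * The maximum of a sample *)

Lemma eq_in_distribution_nat (R : realType) (d1 d2 : measure_display)
    (T1 : measurableType d1) (T2 : measurableType d2)
    (P1 : probability T1 R) (P2 : probability T2 R)
    (f1 : T1 -> nat) (f2 : T2 -> nat) :
  (forall j, measurable (f1 @^-1` [set j])) ->
  (forall j, measurable (f2 @^-1` [set j])) ->
  (forall j, P1 (f1 @^-1` [set j]) = P2 (f2 @^-1` [set j])) ->
  eq_in_distribution P1 P2 f1 f2.
Proof.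
move=> m1 m2 f12 A _; rewrite /pushforward.
have fibers (S : Type) (f : S -> nat) :
    f @^-1` A = \bigcup_(j in A) f @^-1` [set j].
  by apply/seteqP; split => [x Ax|x [j Aj E]]; [exists (f x)|rewrite /preimage/= E].
have triv (S : Type) (f : S -> nat) : trivIset A (fun j => f @^-1` [set j]).
  apply/trivIsetP => i j _ _ ij; apply/seteqP; split => // x [/= xi xj].
  by rewrite -xi -xj eqxx in ij.
rewrite !fibers !measure_bigcup//.
by apply: eq_eseriesr => j _; exact: f12.
Qed.

Section GEM_maximum.
Context (R : realType) (theta : R) (d : measure_display) (T : measurableType d).
Context (P : probability T R) (X : nat -> {RV P >-> nat}).
Hypotheses (theta_gt0 : 0 < theta) (X_pos : forall i w, (0 < X i w)%N).
Hypothesis X_sample : GEM_sample P theta X.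

Let event n k : set T := [set w | (\max_(i < n) X i w <= k)%N].

Let eventE n k : event n k =
  \bigcap_(i in [set` [fset i in iota 0 n]%fset]) X i @^-1` [set x | (x <= k)%N].
Proof.
apply/seteqP; split => w.
  move=> /bigmax_leqP H i /=; rewrite !inE mem_iota add0n => /andP[_ ni].
  exact: (H (Ordinal ni)).
move=> H; apply/bigmax_leqP => i _; apply: (H i) => /=.
by rewrite !inE mem_iota/= add0n.
Qed.

Let measurable_event n k : measurable (event n k).
Proof.
rewrite eventE; apply: fin_bigcap_measurable; first exact: finite_fset.
by move=> i _; exact: measurable_funPTI.
Qed.

(** By conditional independence [Y_k ^ n] is a version of the conditional
    probability that all [n] samples are at most [k]; integrating it over the
    whole space gives the unconditional probability. *)
Lemma GEM_max_cdf n k : (0 < k)%N ->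
  P [set w | (\max_(i < n) X i w <= k)%N] = (stick_moment theta n k)%:E.
Proof.
move=> k0; have [H [indepH betaH [indepX cdfX]]] := X_sample.
rewrite -/(event n k) eventE -(stick_breaking_moment theta_gt0 indepH betaH).
have [_ _ /(_ setT)] := indepX [fset i in iota 0 n]%fset
  (fun=> [set x | (x <= k)%N]) (fun=> stick_breaking H k)
  (fun=> I) (fun i => cdfX i k k0).
rewrite setIT => <-.
  apply: eq_integral => w _; congr (_%:E).
  rewrite -[RHS](_ : \prod_(i <- iota 0 n) stick_breaking H k w = _).
    apply: perm_big; apply: uniq_perm => //; first exact: iota_uniq.
    by move=> i; rewrite !inE.
  have := @prodr_const_nat R 0 n (stick_breaking H k w).
  by rewrite /index_iota subn0.
have [G0 GD _] := smallest_sigma_algebra [set: T]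
  (\bigcup_i preimage_set_system setT (stick_breaking H i) measurable).
by rewrite -(setD0 setT); exact: GD.
Qed.

Lemma GEM_max_fiber n j : (0 < n)%N ->
  (fun w => \max_(i < n) X i w - 1)%N @^-1` [set j] = event n j.+1 `\` event n j.
Proof.
move=> n0; apply/seteqP.
have M0 w : (0 < \max_(i < n) X i w)%N.
  exact: leq_trans (X_pos 0 w) (leq_bigmax (Ordinal n0)).
split => w; rewrite /event /=.
  move=> <-; rewrite subn1 prednK//; split => //.
  by apply/negP; rewrite -ltnNge prednK.
move=> [Mj /negP]; rewrite -ltnNge => jM.
by apply/eqP; rewrite subn1 -eqSS prednK// eqn_leq Mj.
Qed.

Lemma GEM_max_law n j : (0 < n)%N ->
  measurable ((fun w => \max_(i < n) X i w - 1)%N @^-1` [set j]) /\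
  P ((fun w => \max_(i < n) X i w - 1)%N @^-1` [set j]) =
    (GEM_max_pmf theta n j)%:E.
Proof.
move=> n0; rewrite GEM_max_fiber//; split; first exact: measurableD.
rewrite measureD//; last by rewrite -ge0_fin_numE// fin_num_measure.
have -> : event n j.+1 `&` event n j = event n j.
  by rewrite setIidr// => w /leqW.
rewrite /GEM_max_pmf EFinB; congr (_ - _)%E; first exact: GEM_max_cdf.
case: j => [|j]; last by rewrite mul1r; exact: GEM_max_cdf.
rewrite mul0r (_ : event n 0 = set0) ?measure0//.
apply/seteqP; split => // w; rewrite /event/= leqNgt => /negP; apply.
exact: leq_trans (X_pos 0 w) (leq_bigmax (Ordinal n0)).
Qed.

End GEM_maximum.

Theorem theorem1 (R : realType) (theta : R) (theta_gt0 : 0 < theta)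
    (d : measure_display) (T : measurableType d) (P : probability T R)
    (X : nat -> {RV P >-> nat})
    (X_pos : forall i w, (0 < X i w)%N)
    (X_sample : GEM_sample P theta X)
    (n : nat) (n_gt0 : (0 < n)%N)
    (d' : measure_display) (T' : measurableType d') (Q : probability T' R)
    (G : 'I_n -> {RV Q >-> nat})
    (G_indep : mutually_independent Q G)
    (G_geom : forall i : 'I_n,
       has_geometric_distribution (i.+1%:R / (theta + i.+1%:R)) (G i)) :
  eq_in_distribution P Q
    (fun w => (\max_(i < n) X i w - 1)%N)
    (fun w => (\sum_(i < n) G i w)%N).
Proof.
apply: eq_in_distribution_nat => j.
- by have [] := GEM_max_law theta_gt0 X_pos X_sample j n_gt0.
- exact: measurable_geometric_sum.
- have [_ ->] := GEM_max_law theta_gt0 X_pos X_sample j n_gt0.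
  by rewrite [RHS](geometric_sum_law theta_gt0 G_indep G_geom).
Qed.
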